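(* Let $G$ be a connected graph (without loops), and $r$ a positive integer such that $\operatorname{diam}(G)\geq r$. (a) If $r\equiv 0 \pmod{3}$, then $$e(G^r)\geq \left(\frac{r+3}{6}-\frac{3}{4(r+3)} \right) \delta(G)\, |G|.$$ (b) If $r\not\equiv 0 \pmod{3}$, then $$e(G^r)\geq \frac{1}{2}\left\lceil \frac{r}{3} \right\rceil \delta(G)\, |G|.$$
   Context: Graphs here are finite, undirected, with no loops and no multiple edges. $|G|$ denotes the number of vertices of $G$, $e(G)$ the number of edges of $G$, $\delta(G)$ the minimum degree of $G$, and $d(x,y)$ the length of a shortest path between $x$ and $y$ in $G$. For a positive integer $r$, the $r$th power $G^r$ of $G$ is the (loopless) graph with vertex set $V(G)$ in which two distinct vertices $x,y$ are adjacent if and only if $d(x,y)\le r$ in $G$. The diameter $\operatorname{diam}(G)$ of a connected graph $G$ is the smallest $r$ for which $G^r$ is complete, i.e. the maximum distance between two vertices of $G$. *)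

(* Defs.v *)
From mathcomp Require Import all_boot.

Set Implicit Arguments.
Unset Strict Implicit.
Unset Printing Implicit Defensive.

Record sgraph := SGraph {
  vertex :> finType;
  adj : rel vertex;
  adj_sym : symmetric adj;
  adj_irrefl : irreflexive adj }.

Definition edges (G : sgraph) : {set {set G}} :=
  [set [set p.1; p.2] | p : G * G & adj p.1 p.2].

Definition num_edges (G : sgraph) : nat := #|edges G|.

Definition degree (G : sgraph) (x : G) : nat := #|[set y | adj x y]|.

(* Every degree is less than #|G|, so the default value #|G| is never the
   minimum of a nonempty graph. *)
Definition min_degree (G : sgraph) : nat :=
  \big[minn/#|G|]_(x : G) degree x.

Definition connected (G : sgraph) : Prop :=
  0 < #|G| /\ forall x y : G, connect (@adj G) x y.

(* n counts edges: the path is x :: p. *)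
Definition has_path (G : sgraph) (n : nat) (x y : G) : bool :=
  [exists p : n.-tuple G,
    [&& path (@adj G) x p, uniq (x :: p) & last x p == y]].

(* A path has fewer than #|G| edges; dist x y takes the junk value #|G|
   exactly when no path joins x and y. *)
Definition dist (G : sgraph) (x y : G) : nat :=
  find (fun n => has_path n x y) (iota 0 #|G|).

(* The maximum distance; meaningful for connected G. *)
Definition diam (G : sgraph) : nat := \max_(x : G) \max_(y : G) dist x y.

Lemma has_path_symW (G : sgraph) n (x y : G) : has_path n x y -> has_path n y x.
Proof.
case/existsP=> p /and3P[px up /eqP <-]; apply/existsP.
have sz : size (rev (belast x p)) == n by rewrite size_rev size_belast size_tuple.
exists (Tuple sz) => /=; apply/and3P; split.
- by rewrite rev_path -(eq_path (e := @adj G)) // => u v; rewrite adj_sym.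
- by have := up; rewrite lastI -rev_uniq rev_rcons.
- by case: (tval p) => [|a s] //=; rewrite rev_cons last_rcons.
Qed.

Lemma dist_sym (G : sgraph) (x y : G) : dist x y = dist y x.
Proof. by apply: eq_find => n; apply/idP/idP; apply: has_path_symW. Qed.

(* The connectivity test excludes the junk value of dist. *)
Definition power_adj (G : sgraph) (r : nat) : rel G :=
  fun x y => [&& x != y, connect (@adj G) x y & dist x y <= r].

Lemma power_adj_sym (G : sgraph) r : symmetric (@power_adj G r).
Proof.
move=> x y; rewrite /power_adj eq_sym dist_sym.
by rewrite (sym_connect_sym (@adj_sym G)).
Qed.

Lemma power_adj_irrefl (G : sgraph) r : irreflexive (@power_adj G r).
Proof. by move=> x; rewrite /power_adj eqxx. Qed.

Definition power (G : sgraph) (r : nat) : sgraph :=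
  SGraph (@power_adj_sym G r) (@power_adj_irrefl G r).

(* Main.v *)
Require Import Defs.
From mathcomp Require Import all_boot all_order all_algebra.
From mathcomp Require Import zify ring lra.

Set Implicit Arguments.
Unset Strict Implicit.
Unset Printing Implicit Defensive.

(** Why the theorem holds.  Write [D] for the minimum degree plus one, so that
    every ball of radius 1 has at least [D] elements; these balls are disjoint
    around vertices that are pairwise at distance at least 3 ([packing]).
    Twice the number of edges of [power G r] is the sum of the sizes of the
    balls of radius [r], minus the number of vertices, so everything reduces to
    bounding that sum from below.

    If 3 does not divide [r], already each ball of radius [r] is large enough:
    along a geodesic of length [r] the vertices number 0, 3, 6, ... up to
    [r - 1] have disjoint neighbourhoods inside the ball ([card_ball_ge]).

    Let [r = 3k].  The average ball must have size
    [(k + 1 - 1 / (2 (k + 1))) D], and packing along a geodesic only guarantees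
    [k D].  Call a vertex bad when its ball is smaller than [(k + 1) D].

    - Two bad vertices are at distance at most 2 or at least [3k]
      ([bad_close]), and the first alternative is an equivalence relation, so
      bad vertices come in clusters far away from each other.
    - The ball of a bad vertex contains its whole cluster and, disjointly from
      it, [k] neighbourhoods ([card_ball_cluster]).  A cluster of size [c] thus
      lacks at most [c (D - c)] in total, which is at most [D^2 / 4].
    - It remains to see that [t] clusters force about [t (k + 1) / 2 * D]
      vertices, since then the total lack [t D^2 / 4] is at most
      [n D / (2 (k + 1))], where [n] is the number of vertices.  Take a geodesic
      of length [3k] from a representative of each cluster.  Near their starting
      points, that is up to distance about [3k / 2], they are far apart, and
      packing along them gives [t * ceil (k / 2)] disjoint neighbourhoods.
      For odd [k] this is enough.
    - For even [k = 2j] half a neighbourhood per cluster is missing.  It is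
      taken from the neighbourhoods of the midpoints, at distance [3j] from the
      representatives.  These may overlap, but a vertex [y] which lies in [q] of
      them sees the beginnings of [q] geodesics, so its ball has at least
      [(q j + 1) D] elements ([card_ball_seen]): the surplus of [y] pays for the
      overlap. *)

(** * Walks and distance *)

Lemma walk_dist (G : sgraph) (x : G) p :
  path (@adj G) x p -> dist x (last x p) <= size p.
Proof.
case/shortenP=> q xq uq sqp.
have qp : size q <= size p by apply: uniq_leq_size => //; case/andP: uq.
apply: leq_trans qp; rewrite leqNgt; apply/negP => lt.
have qG : size q < #|G|.
  by have /card_uniqP /= <- := uq; apply: max_card.
have := before_find 0 lt; rewrite nth_iota // add0n => /negbT/negP; apply.
by apply/existsP; exists (in_tuple q); apply/and3P.
Qed.

Lemma dist_walk (G : sgraph) (x y : G) : connected G ->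
  exists p, [/\ path (@adj G) x p, last x p = y & size p = dist x y].
Proof.
case=> _ /(_ x y) /connectP[p xp ->].
have : has (fun n => has_path n x (last x p)) (iota 0 #|G|).
  case/shortenP: xp => q xq uq _; apply/hasP; exists (size q).
    rewrite mem_iota /= add0n.
    by have /card_uniqP /= <- := uq; apply: max_card.
  by apply/existsP; exists (in_tuple q); apply/and3P.
move=> hasd; have := nth_find 0 hasd; move: (hasd).
rewrite has_find size_iota => lt.
rewrite nth_iota // add0n => /existsP[q /and3P[xq _ /eqP lq]].
by exists q; rewrite size_tuple.
Qed.

Section Metric.
Variables (G : sgraph) (cG : connected G).
Implicit Types x y z : G.

Lemma dist_triangle y x z : dist x z <= dist x y + dist y z.
Proof.
have [p [xp lp <-]] := dist_walk x y cG; have [q [yq <- <-]] := dist_walk y z cG.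
by rewrite -size_cat -lp -last_cat walk_dist // cat_path xp lp.
Qed.

Lemma distxx x : dist x x = 0.
Proof. by apply/eqP; rewrite -leqn0; apply: (@walk_dist G x [::]). Qed.

Lemma dist_adj x y : adj x y -> dist x y <= 1.
Proof. by move=> xy; apply: (@walk_dist G x [:: y]); rewrite /= xy. Qed.

(** Geodesics are functions on [nat], of which only the values up to [L] matter;
    this avoids dependent indices when every third vertex is selected. *)
Definition geodesic L (g : nat -> G) :=
  forall a b, a <= b <= L -> dist (g a) (g b) = b - a.

Lemma exists_geodesic L u v : L <= dist u v ->
  exists g, geodesic L g /\ g 0 = u.
Proof.
have [p [up lp sp]] := dist_walk u v cG => Ld.
pose g i := nth u (u :: p) i; exists g; split=> // a b /andP[ab bL].
(* consecutive vertices are adjacent, which bounds every distance from above;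
   the total length then forces equality *)
have step i n : i + n <= dist u v -> dist (g i) (g (i + n)) <= n.
  elim: n => [|n IHn] le_in; first by rewrite addn0 distxx.
  apply: leq_trans (dist_triangle (g (i + n)) _ _) _.
  rewrite -addn1 leq_add ?IHn ?(leq_trans _ le_in) ?leq_add2l // dist_adj //.
  rewrite addn1 addnS /g /=; apply: (pathP u up); lia.
have xv : g (dist u v) = v by rewrite /g -sp -last_nth.
have h1 : dist u (g a) <= a by apply: (step 0); lia.
have h2 : dist (g a) (g b) <= b - a by rewrite -{1}(subnKC ab) step //; lia.
have h3 : dist (g b) v <= dist u v - b.
  by rewrite -{1}xv -{1}(subnKC (leq_trans bL Ld)) step //; lia.
have := dist_triangle (g a) u v; have := dist_triangle (g b) (g a) v; lia.
Qed.

Definition ball n x : {set G} := [set y | dist x y <= n].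

Lemma mem_ball n x y : (y \in ball n x) = (dist x y <= n).
Proof. by rewrite inE. Qed.

Lemma ball_sub_ball m n x y : dist y x + m <= n -> ball m x \subset ball n y.
Proof.
move=> le_n; apply/subsetP => z; rewrite !mem_ball => xz.
have := dist_triangle x y z; lia.
Qed.

Lemma card_ball1 x : #|ball 1 x| >= (min_degree G).+1.
Proof.
have le_deg : min_degree G <= degree x.
  rewrite /min_degree; have := mem_index_enum x.
  elim: (index_enum _) => // y s IHs; rewrite inE big_cons => /predU1P[<-|/IHs le].
    exact: geq_minl.
  by rewrite geq_min le orbT.
have sub : x |: [set y | adj x y] \subset ball 1 x.
  apply/subsetP => y; rewrite !inE => /predU1P[->|]; first by rewrite distxx.
  exact: dist_adj.
apply: leq_trans (subset_leq_card sub); rewrite cardsU1 inE adj_irrefl.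
by rewrite add1n ltnS.
Qed.

(** Disjointness makes each element of [A] count for at most one index, as two
    centres with a common neighbour would be at distance at most 2. *)
Lemma packing (I : finType) (P : pred I) (f : I -> G) (A : {set G}) :
    (forall i j, P i -> P j -> i != j -> 3 <= dist (f i) (f j)) ->
    (forall i, P i -> ball 1 (f i) \subset A) ->
  #|P| * (min_degree G).+1 <= #|A|.
Proof.
move=> sep subA; rewrite -sum_nat_const.
apply: (@leq_trans (\sum_(i in P) \sum_(y in A) (y \in ball 1 (f i)))).
  apply: leq_sum => i Pi; apply: leq_trans (card_ball1 (f i)) _.
  rewrite -big_mkcondr sum1_card; apply: subset_leq_card.
  by apply/subsetP => y yi; apply/andP; split=> //; apply: (subsetP (subA i Pi)).
rewrite exchange_big /= -sum1_card; apply: leq_sum => y _.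
rewrite -big_mkcondr sum1_card; apply/card_le1P => i /andP[Pi yi] j.
apply/idP/idP => [/andP[Pj yj]|/eqP->]; last by apply/andP.
apply: contraTT isT => ji; have := sep _ _ Pj Pi ji.
have := dist_triangle y (f j) (f i); rewrite (dist_sym y).
by move: yi yj; rewrite !mem_ball; lia.
Qed.

End Metric.

(** * Neighbourhoods packed along a geodesic *)

Section Packings.
Variables (G : sgraph) (cG : connected G).
Local Notation D := (min_degree G).+1.

Lemma dist_geodesic L (g : nat -> G) a b :
  geodesic L g -> a <= L -> b <= L -> dist (g a) (g b) = (a - b) + (b - a).
Proof.
move=> geo aL bL; have [ab|ba] := leqP a b; first by rewrite geo; lia.
by rewrite dist_sym geo; lia.
Qed.

(** Every third vertex of a geodesic is a centre; the offset [c] is 0, or 2 when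
    the surroundings of the origin are to be avoided. *)
Lemma geodesic_packing L (g : nat -> G) m c (A : {set G}) :
    geodesic L g -> (forall i, i < m -> 3 * i + c <= L) ->
    (forall i, i < m -> ball 1 (g (3 * i + c)) \subset A) ->
  m * D <= #|A|.
Proof.
move=> geo inL subA; rewrite -{1}(card_ord m).
apply: (packing cG (f := fun i : 'I_m => g (3 * i + c))) => [i j _ _|i _].
  by rewrite -val_eqE (dist_geodesic geo) ?inL //=; lia.
exact: subA.
Qed.

Lemma diam_le_dist r : 0 < r -> r <= diam G -> exists u v : G, r <= dist u v.
Proof.
move=> r_gt0 r_diam.
have [/existsP[u /existsP[v uv]]|no] :=
  boolP [exists u : G, exists v, r <= dist u v].
  by exists u, v.
suff : diam G <= r.-1 by lia.
apply/bigmax_leqP => u _; apply/bigmax_leqP => v _.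
by move: no; rewrite negb_exists => /forallP/(_ u) /existsPn/(_ v); lia.
Qed.

(** The geodesic starts at [v] if some vertex is at distance [r] from [v];
    otherwise the ball is everything and any geodesic of length [r] will do. *)
Lemma card_ball_ge r (v : G) : 0 < r -> r <= diam G ->
  (r + 2) %/ 3 * D <= #|ball r v|.
Proof.
move=> r_gt0 r_diam.
suff [g [geo subv]] : exists g, geodesic r g /\
    forall i, i < r -> ball 1 (g i) \subset ball r v.
  by apply: (geodesic_packing (c := 0) geo) => i i_lt; last apply: subv; lia.
have [/existsP[w vw]|/existsPn near] := boolP [exists w, r <= dist v w].
  have [g [geo g0]] := exists_geodesic cG vw; exists g; split=> // i ir.
  by apply: (ball_sub_ball cG); rewrite -g0 geo; lia.
have [u [w uw]] := diam_le_dist r_gt0 r_diam.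
have [g [geo _]] := exists_geodesic cG uw; exists g; split=> // i ir.
by apply/subsetP => y _; rewrite mem_ball; have := near y; lia.
Qed.

End Packings.

(** * Clusters of vertices with small balls *)

Section Bad.
Variables (G : sgraph) (cG : connected G) (k : nat).
Hypotheses (k_gt0 : 0 < k) (k_diam : 3 * k <= diam G).
Local Notation D := (min_degree G).+1.

Definition bad : {set G} := [set v | #|ball (3 * k) v| < k.+1 * D].

Lemma card_lt_of_bad v (A : {set G}) : v \in bad -> A \subset ball (3 * k) v ->
  #|A| < k.+1 * D.
Proof. by rewrite inE => vbad /subset_leq_card le; apply: leq_ltn_trans vbad. Qed.

(** If all vertices were at distance less than [3k] from [v], its ball would be
    the whole graph, in which a geodesic of length [3k] has [k + 1] packed centres. *)
Lemma bad_geodesic v : v \in bad -> exists g, geodesic (3 * k) g /\ g 0 = v.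
Proof.
move=> vbad.
have [/existsP[w vw]|/existsPn near] := boolP [exists w, 3 * k <= dist v w].
  by have [g geo_g] := exists_geodesic cG vw; exists g.
have [u [w uw]] := diam_le_dist (ltac:(lia) : 0 < 3 * k) k_diam.
have [g [geo _]] := exists_geodesic cG uw.
have : k.+1 * D <= #|[set: G]|.
  by apply: (geodesic_packing cG (c := 0) geo) => i; rewrite ?subsetT //; lia.
rewrite leqNgt (card_lt_of_bad vbad) //; apply/subsetP => y _; rewrite mem_ball.
by have := near y; lia.
Qed.

(** A vertex [w] close to [g i], with [i] away from the origin, is within
    [3k - 1] of each of the [k + 1] centres [g 0], [g 3], ..., [g (3k)], so its
    ball contains all their neighbourhoods and [w] cannot be bad. *)
Lemma bad_far_from_geodesic g w i :
    geodesic (3 * k) g -> w \in bad -> dist w (g 0) < 3 * k ->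
  3 <= i <= 3 * k -> 3 <= dist w (g i).
Proof.
move=> geo wbad w0 /andP[i3 ik]; rewrite ltnNge; apply/negP => wi.
suff : k.+1 * D <= #|ball (3 * k) w| by rewrite leqNgt (card_lt_of_bad wbad).
apply: (geodesic_packing cG (c := 0) geo) => m mk; first by lia.
apply: (ball_sub_ball cG); rewrite addn0.
case: m mk => [|m] mk; first by rewrite muln0 addn1.
have := dist_triangle cG (g i) w (g (3 * m.+1)).
by rewrite (dist_geodesic geo (a := i)); lia.
Qed.

(** If [v] and [w] were at distance at least 3, then [w] would be a further
    centre for the ball of [v], besides [g 0], [g 3], ..., [g (3k - 3)] on a
    geodesic from [v]: it is far from the last ones by
    [bad_far_from_geodesic]. *)
Lemma bad_close v w : v \in bad -> w \in bad -> dist v w < 3 * k ->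
  dist v w <= 2.
Proof.
move=> vbad wbad vw; rewrite leqNgt; apply/negP => vw3.
have [g [geo g0]] := bad_geodesic vbad.
have far i : i < k -> 3 <= dist w (g (3 * i)).
  case: i => [|i] ik; first by rewrite muln0 g0 dist_sym.
  by apply: bad_far_from_geodesic geo wbad _ _; rewrite ?g0 1?dist_sym //; lia.
suff : #|{: option 'I_k}| * D <= #|ball (3 * k) v|.
  by rewrite card_option card_ord leqNgt (card_lt_of_bad vbad).
pose f (o : option 'I_k) := if o is Some i then g (3 * i) else w.
apply: (packing cG (f := f)).
  case=> [i|] [j|] //= _ _; last by rewrite far.
    have ik := ltn_ord i; have jk := ltn_ord j.
    by rewrite (inj_eq Some_inj) -val_eqE (dist_geodesic geo) /=; lia.
  by rewrite dist_sym far.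
case=> [i|] _ /=; apply: (ball_sub_ball cG); last by lia.
by have ik := ltn_ord i; rewrite -g0 geo; lia.
Qed.

(** For [k >= 2] the triangle inequality and [bad_close] suffice; for [k = 1]
    the neighbourhoods of two distant [u] and [w] would both fit in the ball
    of [v]. *)
Lemma bad_close_trans u v w : u \in bad -> v \in bad -> w \in bad ->
  dist u v <= 2 -> dist v w <= 2 -> dist u w <= 2.
Proof.
move=> ubad vbad wbad uv vw; have uw := dist_triangle cG v u w.
have [k2|k1] := leqP 2 k; first by apply: bad_close => //; lia.
rewrite leqNgt; apply/negP => uw3.
suff : #|{: bool}| * D <= #|ball (3 * k) v|.
  have := card_lt_of_bad vbad (subxx _); rewrite card_bool.
  rewrite (_ : k.+1 = 2); last by lia.
  by rewrite ltnNge => /negP.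
apply: (packing cG (f := fun b : bool => if b then u else w)).
  by case=> [] [] //= _ _ _; rewrite // dist_sym.
by case=> _ /=; apply: (ball_sub_ball cG); have vu := dist_sym v u; lia.
Qed.

Definition cluster (v : G) : {set G} := [set w in bad | dist v w <= 2].

Lemma mem_cluster v w : (w \in cluster v) = (w \in bad) && (dist v w <= 2).
Proof. by rewrite inE. Qed.

(** The [k] neighbourhoods are those of [g 2], [g 5], ..., [g (3k - 1)]: by
    [bad_far_from_geodesic] no bad vertex near [v] is within distance 2 of
    [g 3], [g 6], ..., [g (3k)], hence none is next to these centres. *)
Lemma card_ball_cluster v : v \in bad -> k * D + #|cluster v| <= #|ball (3 * k) v|.
Proof.
move=> vbad; have [g [geo g0]] := bad_geodesic vbad.
have sub : cluster v \subset ball (3 * k) v.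
  by apply/subsetP => w; rewrite !inE => /andP[_]; lia.
rewrite -(cardsID (cluster v) (ball _ _)) (setIidPr sub) addnC leq_add2l.
apply: (geodesic_packing cG (c := 2) geo) => i ik; first by lia.
rewrite subsetD (ball_sub_ball cG) -?g0 ?geo; try lia.
rewrite disjoint_sym; apply/pred0P => w /=; apply/negP => /andP[].
rewrite g0 mem_ball inE dist_sym => /andP[wbad vw] wg.
have := dist_triangle cG (g (3 * i + 2)) w (g (3 * i.+1)).
rewrite (geo (3 * i + 2)); last by lia.
have := @bad_far_from_geodesic g w (3 * i.+1) geo wbad.
by rewrite g0 (dist_sym w (g (3 * i + 2))); lia.
Qed.

(** [T] picks one representative in each cluster.  The inequality sums, over the
    clusters, [4 c (k D + c) + D^2 >= 4 c (k + 1) D], that is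
    [(2 c - D)^2 >= 0], for a cluster of size [c]. *)
Lemma bad_clusters : exists T : {set G},
  [/\ T \subset bad, {in T &, forall u v, u != v -> 3 * k <= dist u v} &
   4 * (k.+1 * D * #|bad|)
     <= 4 * (\sum_(v in bad) #|ball (3 * k) v|) + #|T| * D ^ 2].
Proof.
(* [pick] depends only on the extension of the cluster, so that all members of
   a cluster get the same representative *)
pose rep v := odflt v [pick u in cluster v].
have self v : v \in bad -> v \in cluster v.
  by move=> vbad; rewrite mem_cluster vbad distxx.
have repP v : v \in bad -> rep v \in cluster v.
  by rewrite /rep; case: pickP => // no /self; rewrite no.
have rep_eq u v : u \in bad -> v \in bad -> dist u v <= 2 -> rep u = rep v.
  move=> ubad vbad uv; have eqC : cluster u =i cluster v.
    move=> w; rewrite !mem_cluster; case: (boolP (w \in bad)) => //= wbad.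
    by apply/idP/idP; apply: bad_close_trans; rewrite // dist_sym.
  by rewrite /rep (eq_pick eqC); case: pickP => // no; have := no v; rewrite self.
have repK v : v \in bad -> rep v \in bad /\ rep (rep v) = rep v.
  move=> vbad; have := repP v vbad; rewrite mem_cluster => /andP[rbad vr].
  by split=> //; apply/esym/rep_eq.
exists (rep @: bad); split.
- by apply/subsetP => _ /imsetP[v vbad ->]; case: (repK v vbad).
- move=> _ _ /imsetP[u /repK[ubad uK] ->] /imsetP[v /repK[vbad vK] ->].
  by apply: contraNleq => /bad_close-/(_ ubad vbad)/rep_eq; rewrite uK vK => ->.
rewrite (partition_big rep (mem (rep @: bad))) /=; last by move=> v; apply: imset_f.
rewrite -sum_nat_const big_distrr /= -big_split /= -sum1_card.
rewrite big_distrr /= big_distrr /=.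
rewrite (partition_big rep (mem (rep @: bad))) /=; last by move=> v; apply: imset_f.
apply: leq_sum => _ /imsetP[v vbad ->]; have [rbad rK] := repK v vbad.
have fib w : (w \in bad) && (rep w == rep v) = (w \in cluster (rep v)).
  apply/idP/idP => [/andP[wbad /eqP <-]|].
    by have := repP w wbad; rewrite !mem_cluster wbad dist_sym => /andP[].
  rewrite mem_cluster => /andP[wbad /rep_eq <- //]; by rewrite wbad rK eqxx.
rewrite (eq_bigl _ _ fib) [X in _ <= 4 * X + _](eq_bigl _ _ fib).
rewrite -!big_distrr /= sum1_card.
set c := #|cluster _|.
have le : c * (k * D + c) <= \sum_(w in cluster (rep v)) #|ball (3 * k) w|.
  rewrite /c -sum_nat_const; apply: leq_sum => w.
  rewrite -fib => /andP[wbad /eqP rw]; apply: leq_trans (card_ball_cluster wbad).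
  rewrite leq_add2l; apply: subset_leq_card; apply/subsetP => x.
  rewrite -fib -rw => /andP[xbad /eqP rx].
  rewrite mem_cluster xbad /=; have := repP x xbad; have := repP w wbad.
  rewrite rx !mem_cluster => /andP[r'bad wr] /andP[_ xr].
  by apply: (bad_close_trans wbad r'bad xbad wr); rewrite dist_sym.
have [amgm _] := nat_Cauchy (2 * c) D; move: le amgm; rewrite -!mulnn.
by move: c D (\sum_(w in _) _) => c d S; nia.
Qed.

End Bad.

(** * Geodesics from far apart vertices *)

Section Separated.
Variables (G : sgraph) (cG : connected G) (k : nat).
Variables (T : {set G}) (g : G -> nat -> G).
Hypothesis sepT : {in T &, forall u v, u != v -> 3 * k <= dist u v}.
Hypothesis geoT : {in T, forall v, geodesic (3 * k) (g v) /\ g v 0 = v}.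
Local Notation D := (min_degree G).+1.

Lemma dist_branches u v a b : u \in T -> v \in T -> u != v ->
  a <= 3 * k -> b <= 3 * k -> 3 * k <= a + dist (g u a) (g v b) + b.
Proof.
move=> uT vT uv ak bk; have := sepT uT vT uv.
have [geou gu0] := geoT uT; have [geov gv0] := geoT vT.
have := dist_triangle cG (g u a) u v; have := dist_triangle cG (g v b) (g u a) v.
have ua : dist u (g u a) = a by rewrite -{1}gu0 geou ?subn0.
have vb : dist (g v b) v = b by rewrite dist_sym -{1}gv0 geov ?subn0.
lia.
Qed.

(** The centres used have indices at most [3 (h - 1)], and
    [6 (h - 1) + 3 <= 3 k] keeps those of different geodesics at distance at
    least 3. *)
Lemma branch_packing h (S A : {set G}) :
    S \subset T -> 6 * h <= 3 * k + 3 ->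
    (forall v i, v \in S -> i < h -> ball 1 (g v (3 * i)) \subset A) ->
  #|S| * h * D <= #|A|.
Proof.
move=> /subsetP ST hk subA.
rewrite (_ : #|S| * h = #|[predX S & 'I_h]|); last by rewrite cardX card_ord.
apply: (packing cG (f := fun p : G * 'I_h => g p.1 (3 * p.2))).
  move=> [u i] [v j] /andP[/= uS _] /andP[/= vS _]; rewrite xpair_eqE.
  have ih := ltn_ord i; have jh := ltn_ord j.
  have [<-|uv] /= := eqVneq u v.
    rewrite -val_eqE (dist_geodesic (geoT (ST _ uS)).1) /=; lia.
  by have := @dist_branches u v (3 * i) (3 * j); rewrite !ST // uv; lia.
by move=> [v i] /andP[/= vS _]; apply: subA.
Qed.

Section Even.
Variable j : nat.
Hypothesis (j_gt0 : 0 < j) (k2j : k = 2 * j).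

Definition mid v := g v (3 * j).

(** Two midpoints may have distance 0, but a midpoint is still far from all the
    earlier centres: here [3 i + 3 j + 2 < 3 k]. *)
Lemma mid_disjoint u v i : u \in T -> v \in T -> i < j ->
  [disjoint ball 1 (g u (3 * i)) & ball 1 (mid v)].
Proof.
move=> uT vT ij; apply/pred0P => y /=; apply/negP; rewrite !mem_ball => /andP[uy vy].
rewrite /mid in vy *; have := dist_triangle cG y (g u (3 * i)) (g v (3 * j)).
rewrite (dist_sym y).
have [uv|uv] := eqVneq u v.
  by rewrite uv in uy *; rewrite (dist_geodesic (geoT vT).1); lia.
by have := @dist_branches u v (3 * i) (3 * j) uT vT uv; lia.
Qed.

Definition seen y : {set G} := [set v in T | y \in ball 1 (mid v)].

Lemma sum_seen : #|T| * D <= \sum_y #|seen y|.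
Proof.
rewrite -sum_nat_const.
rewrite [X in _ <= X](eq_bigr (fun y =>
  \sum_(v in T) (y \in ball 1 (mid v)))) => [|y _].
  rewrite exchange_big /=; apply: leq_sum => v _; rewrite -big_mkcond sum1_card.
  exact: card_ball1.
by rewrite -big_mkcondr -sum1_card; apply: eq_bigl => v; rewrite inE.
Qed.

Lemma card_seen : #|T| * j * D + #|[set y | 0 < #|seen y|]| <= #|G|.
Proof.
rewrite addnC -(cardsC [set y | 0 < #|seen y|]) leq_add2l.
apply: branch_packing => // [|v i vT ij]; first by lia.
apply/subsetP => y vy; rewrite !inE -leqNgt leqn0 cards_eq0; apply/eqP/setP => u.
rewrite !inE; apply/negP => /andP[uT uy].
by have /pred0P/(_ y) /= := mid_disjoint vT uT ij; rewrite vy mem_ball uy.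
Qed.

(** From [y], next to a midpoint, one reaches within [1 + 3 j + 1 <= 3 k] steps
    the neighbourhoods of the first [j] centres on each geodesic that [y] sees;
    the remaining summand [D] is the neighbourhood of one midpoint. *)
Lemma card_ball_seen y : 0 < #|seen y| ->
  (#|seen y| * j).+1 * D <= #|ball (3 * k) y|.
Proof.
case/card_gt0P => v; rewrite inE => /andP[vT yv].
have near u : u \in seen y -> dist y (mid u) <= 1.
  by rewrite inE mem_ball dist_sym => /andP[].
have sub : ball 1 (mid v) \subset ball (3 * k) y.
  by apply: (ball_sub_ball cG); have := near v; rewrite inE vT yv => /(_ isT); lia.
rewrite -(cardsID (ball 1 (mid v)) (ball _ y)) (setIidPr sub) mulSn.
apply: leq_add; first exact: card_ball1.
have seenT : seen y \subset T by apply/subsetP => u; rewrite inE => /andP[].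
apply: branch_packing => // [|u i useen ij]; first by lia.
have uT := subsetP seenT u useen; rewrite subsetD mid_disjoint // andbT.
apply: (ball_sub_ball cG); have := dist_triangle cG (mid u) y (g u (3 * i)).
have := near u useen.
have -> : dist (mid u) (g u (3 * i)) = 3 * j - 3 * i.
  by rewrite (dist_geodesic (geoT uT).1); lia.
lia.
Qed.

End Even.
End Separated.

(** * The average size of a ball *)

(** With [n] vertices and [K = k + 1], the claim is that the average ball has
    size at least [(K - 1 / (2 K)) D], cleared of denominators.  By
    [bad_clusters], [t] clusters cost at most [t D^2 / 4], so the point is to
    bound [t K D^2] by [2 n D], up to the surplus of the vertices that see
    several midpoints. *)
Lemma sum_card_ball (G : sgraph) (k : nat) : connected G -> 0 < k ->
    3 * k <= diam G ->
  2 * (k.+1 * k.+1 * (min_degree G).+1 * #|G|)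
    <= 2 * k.+1 * (\sum_(v : G) #|ball (3 * k) v|) + #|G| * (min_degree G).+1.
Proof.
move=> cG k_gt0 k_diam; set D := (min_degree G).+1.
have [T [Tbad sepT badsum]] := bad_clusters cG k_gt0 k_diam.
have [g geo] : exists g : G -> nat -> G, forall v, v \in bad G k ->
    geodesic (3 * k) (g v) /\ g v 0 = v.
  apply: (@fin_all_exists G (fun=> nat -> G)
    (fun v gv => v \in bad G k -> geodesic (3 * k) gv /\ gv 0 = v)) => v.
  have [vbad|_] := boolP (v \in bad G k).
    by have [gv] := bad_geodesic cG k_gt0 k_diam vbad; exists gv.
  by exists (fun=> v).
have geoT : {in T, forall v, geodesic (3 * k) (g v) /\ g v 0 = v}.
  by move=> v /(subsetP Tbad); apply: geo.
have good v : v \notin bad G k -> k.+1 * D <= #|ball (3 * k) v|.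
  by rewrite inE -leqNgt.
have card_bad : #|G| = #|bad G k| + #|~: bad G k| by rewrite cardsC.
have sum_bad F : \sum_(v : G) F v
    = \sum_(v in bad G k) F v + \sum_(v in ~: bad G k) F v.
  rewrite (bigID (mem (bad G k))) /=; congr (_ + _).
  by apply: eq_bigl => v; rewrite in_setC.
move: badsum; rewrite -/D sum_bad card_bad.
have [k_odd|k_even] := boolP (odd k).
  have goodsum : #|~: bad G k| * (k.+1 * D)
      <= \sum_(v in ~: bad G k) #|ball (3 * k) v|.
    by rewrite -sum_nat_const; apply: leq_sum => v; rewrite in_setC; apply: good.
  have [h kh] : exists h, k.+1 = 2 * h by exists k.+1./2; lia.
  have nT : #|T| * h * D <= #|G|.
    by rewrite -cardsT; apply: (branch_packing cG sepT geoT) => //; lia.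
  move: nT goodsum; rewrite card_bad kh.
  move: (\sum_(v in bad G k) _) (\sum_(v in ~: _) _) #|T| #|bad G k| #|~: _|.
  move=> S S' t b b'; rewrite -mulnn; nia.
have [j kj] : exists j, k = 2 * j by exists k./2; lia.
have j_gt0 : 0 < j by lia.
(* [s] measures the surplus, in units of [j D]; subtraction is truncated *)
pose q y := #|seen T g j y|; pose s := \sum_(y in ~: bad G k) (q y - 2).
(* a vertex that sees three midpoints has at least [(3 j + 1) D >= (k + 1) D]
   elements in its ball *)
have q_bad y : y \in bad G k -> q y <= 2.
  rewrite inE ltnNge; apply: contraNleq => q3.
  apply: leq_trans (card_ball_seen cG sepT geoT j_gt0 kj _);
    last by rewrite -/(q y); lia.
  by rewrite leq_mul2r /= kj -/(q y); nia.
have goodsum : #|~: bad G k| * (k.+1 * D) + s * (j * D)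
    <= \sum_(v in ~: bad G k) #|ball (3 * k) v|.
  rewrite -sum_nat_const /s big_distrl -big_split /=; apply: leq_sum => y.
  rewrite in_setC => /good good_y; have [q2|q3] := leqP (q y) 2.
    by rewrite (eqP (q2 : q y - 2 == 0)) addn0.
  apply: leq_trans (card_ball_seen cG sepT geoT j_gt0 kj _);
    last by rewrite -/(q y); lia.
  by rewrite -/D -/(q y) kj; nia.
have card_mid := card_seen cG sepT geoT j_gt0 kj.
(* each vertex counts [q y <= 2 + (q y - 2)] *)
have sum_mid : #|T| * D <= 2 * #|[set y | 0 < q y]| + s.
  apply: leq_trans (sum_seen T g j) _.
  have -> : 2 * #|[set y | 0 < q y]| = \sum_y (if 0 < q y then 2 else 0).
    rewrite -sum1_card big_distrr big_mkcond /=.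
    by apply: eq_bigr => y _; rewrite inE muln1.
  rewrite /s [X in _ <= _ + X]big_mkcond -big_split /=; apply: leq_sum => y _.
  rewrite in_setC -/(q y); have := q_bad y; case: (y \in bad G k) => /=.
    by move/(_ isT); case: ifP; lia.
  by move=> _; case: ifP; lia.
move: goodsum card_mid sum_mid; rewrite card_bad -/D.
move: (\sum_(v in bad G k) _) (\sum_(v in ~: _) _) => S S'.
rewrite -[#|[set y | 0 < #|seen T g j y|]|]/(#|[set y | 0 < q y]|).
move: #|T| #|bad G k| #|~: _| #|[set y | _]| s => t b b' a s.
rewrite kj -mulnn => goodsum card_mid sum_mid badsum.
(* Here [K = 2 j + 1], so [t K D^2 = 2 t j D^2 + t D^2].  The first term and
   [2 a D] amount to at most [2 n D] by [card_mid], and the rest of [t D^2] is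
   at most [s D], which the surplus covers as [j > 0]. *)
have midD : 2 * ((t * j * D + a) * D) <= 2 * ((b + b') * D).
  by rewrite leq_mul2l leq_mul2r card_mid !orbT.
have sumD : t * D * D <= (2 * a + s) * D by rewrite leq_mul2r sum_mid orbT.
have sD : s * D <= s * D * j by rewrite leq_pmulr.
have : (2 * j).+1 * (4 * ((2 * j).+1 * D * (b + b')) + 4 * (s * D * j))
    <= (2 * j).+1 * (4 * (S + S') + t * (D * D)).
  by rewrite leq_mul2l; apply/orP; right; lia.
lia.
Qed.

(** * From balls to edges of the power graph *)

(** Each edge is the image of at most two ordered pairs of adjacent vertices. *)
Lemma sum_degree_le (H : sgraph) : \sum_(x : H) degree x <= 2 * num_edges H.
Proof.
pose arcs := [set p : H * H | adj p.1 p.2].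
have -> : \sum_(x : H) degree x = #|arcs|.
  rewrite (eq_bigr (fun x => \sum_(y : H | adj x y) 1)) => [|x _].
    rewrite pair_big_dep sum1_card /=; apply: eq_card => p.
    by rewrite !inE.
  by rewrite /degree -sum1_card; apply: eq_bigl => y; rewrite inE.
rewrite -sum1_card (partition_big (fun p => [set p.1; p.2]) (mem (edges H))) /=.
  rewrite mulnC -sum_nat_const; apply: leq_sum => _ /imsetP[[a b] _ ->] /=.
  rewrite sum1_card; apply: leq_trans (_ : #|[set (a, b); (b, a)]| <= 2).
    apply: subset_leq_card; apply/subsetP => -[u v] /andP[]; rewrite !inE /=.
    move=> uv /eqP e; rewrite !xpair_eqE.
    have : u \in [set a; b] by rewrite -e !inE eqxx.
    have : v \in [set a; b] by rewrite -e !inE eqxx orbT.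
    have : a \in [set u; v] by rewrite e !inE eqxx.
    have : b \in [set u; v] by rewrite e !inE eqxx orbT.
    rewrite !inE (eq_sym a) (eq_sym b) (eq_sym a) (eq_sym b).
    by do 4![case/orP=> /eqP ?]; subst; rewrite ?eqxx ?orbT.
  by rewrite cards2; case: eqP.
by move=> p; rewrite inE => pp; apply: imset_f; rewrite inE.
Qed.

Lemma sum_card_ball_le (G : sgraph) r : connected G ->
  \sum_(x : G) #|ball r x| <= 2 * num_edges (power G r) + #|G|.
Proof.
move=> cG; apply: leq_trans (leq_add (sum_degree_le (power G r)) (leqnn _)).
rewrite -sum1_card -big_split /=; apply: leq_sum => x _.
rewrite (cardsD1 x) mem_ball distxx /= add1n addn1 ltnS; apply: subset_leq_card.
apply/subsetP => y; rewrite !inE eq_sym => /andP[xy xyr].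
by rewrite /adj /= /power_adj xy xyr cG.2.
Qed.

Import Order.TTheory GRing.Theory Num.Theory.
Local Open Scope ring_scope.

Theorem theorem4 (G : sgraph) (r : nat) (hG : connected G) (hr : (0 < r)%N)
    (hdiam : (r <= diam G)%N) :
  ((r = 0 %[mod 3])%N ->
     ((r%:R + 3) / 6 - 3 / (4 * (r%:R + 3)))
       * (min_degree G)%:R * #|G|%:R <= (num_edges (power G r))%:R :> rat)
  /\
  ((r <> 0 %[mod 3])%N ->
     1 / 2 * (Num.ceil (r%:R / 3 : rat))%:~R
       * (min_degree G)%:R * #|G|%:R <= (num_edges (power G r))%:R :> rat).
Proof.
have sumE := sum_card_ball_le r hG; split=> r3.
  have [k rk] : exists k, r = (3 * k)%N by exists (r %/ 3)%N; lia.
  have k_gt0 : (0 < k)%N by lia.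
  subst r.
  have := sum_card_ball hG k_gt0 hdiam; move: sumE.
  move: (\sum_(_ : _) _)%N (num_edges _) (min_degree G) #|G| => S E d n sumE sumS.
  (* each ball contains its centre, which is not an endpoint of an edge to the
     centre; having the minimum degree plus one in [sumS] makes up for this
     loss, as [2 K^2 - 1 >= 2 K] for [K = k + 1 >= 2] *)
  have le : (2 * (k.+1 * k.+1 * d * n) <= 4 * (k.+1 * E) + n * d)%N.
    have : (2 * k.+1 * n + n <= 2 * (k.+1 * k.+1 * n))%N by nia.
    have : (k.+1 * S <= k.+1 * (2 * E + n))%N by rewrite leq_mul2l sumE.
    lia.
  have K0 : (0 : rat) < k.+1%:R by rewrite ltr0n.
  have -> : (3 * k)%:R + 3 = 3 * k.+1%:R :> rat by rewrite natrM -natr1; ring.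
  have : (2 * (k.+1 * k.+1 * d * n))%:R <= (4 * (k.+1 * E) + n * d)%:R :> rat.
    by rewrite ler_nat.
  rewrite natrD !natrM.
  move: (k.+1%:R : rat) (d%:R : rat) (n%:R : rat) (E%:R : rat) K0 => K x y z K0 le'.
  rewrite -(ler_pM2l (_ : 0 < 4 * K)); last by lra.
  clear -K0 le'.
  have -> : 4 * K * ((3 * K / 6 - 3 / (4 * (3 * K))) * x * y)
     = 2 * (K * K * x * y) - y * x by field; lra.
  lra.
pose m := ((r + 2) %/ 3)%N.
have -> : Num.ceil (r%:R / 3 : rat) = m.
  apply: ceil_def; rewrite ltr_pdivlMr // ler_pdivrMr //.
  have : (r <= m * 3)%N by rewrite /m; lia.
  have : (m * 3 < r + 3)%N by rewrite /m; lia.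
  rewrite -(ltr_nat rat) -(ler_nat rat) natrD natrM rmorphB /= pmulrn.
  lra.
have le : (m * min_degree G * #|G| <= 2 * num_edges (power G r))%N.
  have : (#|G| * (m * (min_degree G).+1) <= \sum_(x : G) #|ball r x|)%N.
    rewrite -sum_nat_const; apply: leq_sum => x _; exact: card_ball_ge.
  have : (0 < m)%N by rewrite /m; lia.
  nia.
move: le; rewrite -(ler_nat rat) !natrM -pmulrn; lra.
Qed.
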